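(* Let $X=(X_t)_{t\ge 0}$ be a stable continuous-time Markov process evolving in $\mathbb{N}=\{0,1,2,\dots\}$, with $0$ absorbing and $\mathbb{P}_x(T_0<+\infty)=1$ for all $x\in\mathbb{N}$, where $T_0=\inf\{s\ge 0:\ X_s=0\}$. Suppose that there exist a finite subset $K\subset\mathbb{N}^*=\{1,2,3,\dots\}$, a point $x_0\in K$ and constants $\lambda_0>0$, $c_1>0$, $c_2>0$, $c_3>0$, $c_4>0$ such that, writing $T_K=\inf\{t\ge 0:\ X_t\in K\}$: (H1) for all $t\geq 0$, $$\frac{\inf_{x\in K}\mathbb{P}_{x}(t<T_0)}{\sup_{x\in K}\mathbb{P}_x(t<T_0)}\geq c_1;$$ (H2) $$\sup_{x\in \mathbb{N}^*} \mathbb{E}_x\left(e^{\lambda_0 (T_K\wedge T_0)}\right)\leq c_2\quad\text{and}\quad \mathbb{P}_{x_0}\left(X_t\in K\right)\geq c_3 e^{-\lambda_0 t}\ \text{ for all } t\ge 0;$$ (H3) $$\inf_{x\in\mathbb{N}^*} \mathbb{P}_x(X_1=x_0\mid T_0>1)\geq c_4.$$ Then there exists a unique quasi-stationary distribution $\rho$ for $X$. Moreover, for any probability measure $\mu$ on $\mathbb{N}^*$, $$\left\|\mathbb{P}_\mu(X_t\in\cdot\mid t<T_0)-\rho \right\|_{TV} \leq 2 \left(1-\frac{c_1c_3c_4}{2c_2}\right)^{[t]}\quad\text{for all } t\geq 0.$$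
   Context: The process $X$ is a time-homogeneous continuous-time Markov process with values in $\mathbb{N}=\{0,1,2,\dots\}$. Stable means that every state has a finite total exit rate. $0$ is absorbing means $X_t=0$ for all $t\ge T_0$. $\mathbb{P}_x$, $\mathbb{E}_x$ denote probability and expectation for the process started at $x$, and $\mathbb{P}_\mu$ for the process with initial law $\mu$. A quasi-stationary distribution (QSD) for $X$ is a probability measure $\rho$ on $\mathbb{N}^*=\{1,2,3,\dots\}$ such that $\rho(\cdot)=\mathbb{P}_\rho(X_t\in\cdot\mid t<T_0)$ for all $t\ge 0$. $\|\cdot\|_{TV}$ is the total variation norm for signed measures on $\mathbb{N}^*$, $\|\nu\|_{TV}=|\nu|(\mathbb{N}^* )=\sum_{x\in\mathbb{N}^*}|\nu(\{x\})|$ (so two mutually singular probability measures are at distance $2$). $[t]$ is the integer part of $t$, and $a\wedge b=\min(a,b)$. *)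

(* Defs.v *)
From HB Require Import structures.
From mathcomp Require Import all_boot all_order all_algebra.
From mathcomp Require Import all_classical all_reals all_analysis.

Set Implicit Arguments.
Unset Strict Implicit.
Unset Printing Implicit Defensive.

Import Order.TTheory GRing.Theory Num.Theory.
Import numFieldNormedType.Exports.

Local Open Scope classical_set_scope.
Local Open Scope ring_scope.

Definition positives : set nat := [set x | (0 < x)%N].

Definition supported_on_positives (R : realType) (mu : probability nat R) :
  Prop := mu [set 0%N] = 0%E.

(* Total variation norm on the positive integers of the signed measure [nu];
   extended-real valued, so that no summability is presupposed. *)
Definition tv_norm (R : realType) (nu : set nat -> R) : \bar R :=
  (\sum_(1 <= x <oo) `|nu [set x]|%:E)%E.

(* Equal to 0 when P(B) = 0, by the convention x / 0 = 0. *)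
Definition cond_prob (T : Type) (R : realType) (P : set T -> \bar R)
  (A B : set T) : R := fine (P (A `&` B)) / fine (P B).

Section Process.
Context (R : realType) (d : measure_display) (Omega : measurableType d).

(* [X t] is only meaningful for 0 <= t; [P x] is the law of the process
   started at x. *)
Variables (X : R -> Omega -> nat) (P : nat -> probability Omega R).

Definition history (t : R) : set (set Omega) :=
  <<s [set A | exists u, exists B : set nat,
        [/\ 0 <= u, u <= t & A = X u @^-1` B] ]>>.

(* The Markov property is the elementary one,
     P_x(X_{t+s} \in B | A, X_t = y) = P_y(X_s \in B),  A \in history t,
   with denominators cleared; since the state space is countable it is
   equivalent to P_x(X_{t+s} \in B | history t) = P_{X_t}(X_s \in B).
   Right-continuity is with respect to the discrete topology; no left limit is
   required, so that explosions followed by an immediate return are allowed. *)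
Record is_markov_process : Prop := {
  mp_measurable : forall t, 0 <= t -> measurable_fun setT (X t);
  mp_right_continuous : forall w t, 0 <= t ->
    \forall s \near t^'+, X s w = X t w;
  mp_start : forall x, P x (X 0 @^-1` [set x]) = 1%E;
  mp_markov : forall x y s t (A : set Omega) (B : set nat),
    0 <= s -> 0 <= t -> history t A ->
    P x (A `&` X t @^-1` [set y] `&` X (t + s) @^-1` B) =
    (P x (A `&` X t @^-1` [set y]) * P y (X s @^-1` B))%E
}.

(* The total exit rate of x is lim_(h -> 0+) (1 - P_x(X_h = x)) / h; [cvg]
   asserts that this limit exists in R, i.e. is finite. *)
Definition stable : Prop := forall x : nat,
  cvg ((fun h : R => (1 - fine (P x (X h @^-1` [set x]))) / h) @ 0^'+).

(* Equal to +oo when K is never visited. *)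
Definition hitting_time (K : set nat) (w : Omega) : \bar R :=
  ereal_inf [set t%:E | t in [set t : R | 0 <= t /\ K (X t w)]].

Definition extinction_time : Omega -> \bar R := hitting_time [set 0%N].

Definition survival (t : R) : set Omega :=
  [set w | (t%:E < extinction_time w)%E].

Definition zero_absorbing : Prop := forall x,
  {ae P x, forall w, forall t, (extinction_time w <= t%:E)%E -> X t w = 0%N}.

Definition almost_sure_extinction : Prop := forall x,
  P x [set w | (extinction_time w < +oo)%E] = 1%E.

(* P_mu = sum_x mu({x}) P_x *)
Definition initial_law (mu : probability nat R) (A : set Omega) : \bar R :=
  (\int[mu]_x P x A)%E.

Definition conditioned_law (mu : probability nat R) (t : R) (A : set nat) : R :=
  cond_prob (initial_law mu) (X t @^-1` A) (survival t).

Definition is_qsd (rho : probability nat R) : Prop :=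
  supported_on_positives rho /\
  forall t, 0 <= t -> forall A : set nat, A `<=` positives ->
    fine (rho A) = conditioned_law rho t A.

Definition H1 (K : set nat) (c1 : R) : Prop := forall t, 0 <= t ->
  c1 <= inf [set fine (P x (survival t)) | x in K] /
        sup [set fine (P x (survival t)) | x in K].

Definition H2 (K : set nat) (x0 : nat) (lambda0 c2 c3 : R) : Prop :=
  (ereal_sup [set \int[P x]_w
       expeR (lambda0%:E * mine (hitting_time K w) (extinction_time w))
     | x in positives] <= c2%:E)%E /\
  forall t, 0 <= t ->
    ((c3 * expR (- lambda0 * t))%:E <= P x0 (X t @^-1` K))%E.

Definition H3 (x0 : nat) (c4 : R) : Prop :=
  c4 <= inf [set cond_prob (P x) (X 1 @^-1` [set x0]) (survival 1)
            | x in positives].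

End Process.

(* Main.v *)
Require Import Defs.
From HB Require Import structures.
From mathcomp Require Import all_boot all_order all_algebra.
From mathcomp Require Import all_classical all_reals all_analysis.
From mathcomp Require Import measurable_realfun.
From mathcomp Require Import ring lra.

Set Implicit Arguments.
Unset Strict Implicit.
Unset Printing Implicit Defensive.

Import Order.TTheory GRing.Theory Num.Theory.
Import numFieldNormedType.Exports.

Local Open Scope classical_set_scope.
Local Open Scope ring_scope.

(** Write [h_t(x)] for the probability that the process started at [x] is alive
    at time [t].

    Domination: [h_t(x)] is at most [2 c2 / (c1 c3)] times [h_t(x0)], for every
    [x >= 1].  Either the path from [x] has reached neither [K] nor [0] by time
    [t], which by the exponential moment has probability at most
    [c2 exp(- lambda0 t)], and [exp(- lambda0 t)] is at most [h_t(x0) / c3]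
    because [x0] can stay in [K]; or it enters [K] at some time [s <= t].  From
    a point [y] of [K] the chance [h_(t - s)(y)] of surviving the remaining
    time is at most [exp(lambda0 s) h_t(x0) / (c1 c3)]: starting from [x0] one
    may wait in [K] until [s], at the price [c3 exp(- lambda0 s)], and then
    survive as well as from [y], up to [c1].  Averaging [exp(lambda0 s)] over
    the entrance time costs the same exponential moment.  The Markov property
    is given at deterministic times only, so the entrance time is located on a
    grid of mesh [1 / (n + 1)]; by right-continuity the path is still in [K] at
    the next grid point once [n] is large.  This is [survival_dominated].

    Minorization: a path alive at time 1 sits at [x0] with probability at least
    [c4], and by domination no other position makes survival for a further
    time [s] more than [2 c2 / (c1 c3)] times as likely.  So, conditionally on
    being alive at time [1 + s], the position at time 1 is [x0] with
    probability at least [b = c1 c3 c4 / (2 c2)], whatever the initial state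
    and whatever [s].  This is [doeblin_minorization].

    Contraction: fix a set [A] of positive states and suppose that the
    conditional probability of being in [A] at time [s], given survival, lies
    in [[m, M]] for all initial states.  One more unit of time in front
    replaces it by an average that gives weight at least [b] to its value at
    [x0], so its range shrinks by the factor [1 - b] ([doeblin_step]).  The
    bounds survive averaging over the initial law and adding time in front, so
    the conditional probabilities converge as time grows, at the rate
    [(1 - b) ^ [t]], uniformly in the initial law and in [A].  Uniformity in
    [A] makes the limit a probability ([setwise_limit]) and allows the limit
    to be taken in the semigroup identity, which gives quasi-stationarity.  A
    quasi-stationary law is its own conditioned law, hence equals the limit.
    The total variation of the difference of two probabilities is at most
    twice its largest value on a set ([tv_norm_le]); this is the factor 2. *)

(** * Integrals against a probability on the integers *)

Section NatProbability.
Context {R : realType}.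
Implicit Types (C c : R) (mu : probability nat R) (f g : nat -> R).

Lemma fin_num_prob d (T : measurableType d) (mu : probability T R) (A : set T) :
  measurable A -> mu A \is a fin_num.
Proof. by move=> mA; exact: fin_num_measure. Qed.

Lemma fine_prob_ge0 d (T : measurableType d) (mu : probability T R) (A : set T) :
  0 <= fine (mu A).
Proof. exact/fine_ge0. Qed.

Lemma fine_prob_le1 d (T : measurableType d) (mu : probability T R) (A : set T) :
  measurable A -> fine (mu A) <= 1.
Proof.
by move=> mA; rewrite -lee_fin fineK ?fin_num_prob//; exact: probability_le1.
Qed.

Lemma le_fine_prob d (T : measurableType d) (mu : probability T R) (A B : set T) :
  measurable A -> measurable B -> A `<=` B -> fine (mu A) <= fine (mu B).
Proof.
move=> mA mB AB; apply: fine_le; rewrite ?fin_num_prob//.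
by apply: le_measure; rewrite ?inE.
Qed.

Lemma fine_probU d (T : measurableType d) (mu : probability T R) (A B : set T) :
  measurable A -> measurable B -> A `&` B = set0 ->
  fine (mu (A `|` B)) = fine (mu A) + fine (mu B).
Proof.
by move=> mA mB AB; rewrite measureU// fineD ?fin_num_prob.
Qed.

Definition mean mu f : R := \int[mu]_y f y.

Lemma integrable_nat mu f C : (forall y, `|f y| <= C) ->
  mu.-integrable setT (EFin \o f).
Proof.
move=> fC; apply: measurable_bounded_integrable => //.
- by apply: (le_lt_trans (probability_le1 mu _)); rewrite ?ltry.
- exists C; split; first by rewrite num_real.
  by move=> x Cx y _ /=; exact: le_trans (fC y) (ltW Cx).
Qed.

Lemma integral_nat mu f : (forall y, 0 <= f y) ->
  (\int[mu]_y (f y)%:E = \sum_(0 <= y <oo) mu [set y] * (f y)%:E)%E.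
Proof.
move=> f0.
have {1}-> : [set: nat] = \bigcup_y [set y].
  by apply/seteqP; split => // y _; exists y.
rewrite ge0_integral_bigcup//; first last.
- by move=> i j _ _ [x [/= -> ->]].
- by move=> x _; rewrite lee_fin.
apply: eq_eseriesr => y _.
rewrite (eq_integral (cst (f y)%:E)).
  by rewrite integral_cst// muleC.
by move=> z /[!inE] /= ->.
Qed.

Lemma mean_cvg mu f C : (forall y, 0 <= f y <= C) ->
  (\sum_(0 <= y < n) fine (mu [set y]) * f y) @[n --> \oo] --> mean mu f.
Proof.
move=> fC; have f0 y : 0 <= f y by case/andP: (fC y).
have fi : mu.-integrable setT (EFin \o f).
  by apply: (@integrable_nat _ _ C) => y; rewrite ger0_norm//; case/andP: (fC y).
have fin : (\int[mu]_y (f y)%:E)%E \is a fin_num by exact: integrable_fin_num fi.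
have {fin} : (\sum_(0 <= y < n) fine (mu [set y]) * f y)%:E @[n --> \oo] -->
    (mean mu f)%:E.
  rewrite /mean /Rintegral fineK// integral_nat//.
  have E n : ((\sum_(0 <= y < n) fine (mu [set y]) * f y)%:E =
      \sum_(0 <= y < n) mu [set y] * (f y)%:E)%E.
    by rewrite -sumEFin; apply: eq_bigr => y _; rewrite EFinM fineK ?fin_num_prob.
  under eq_fun do rewrite E.
  by apply: is_cvg_nneseries => n _ _; rewrite mule_ge0// lee_fin.
exact: fine_cvg.
Qed.

Lemma le_mean mu f g C : (forall y, `|f y| <= C) -> (forall y, `|g y| <= C) ->
  (forall y, f y <= g y) -> mean mu f <= mean mu g.
Proof.
move=> fC gC fg; apply: le_Rintegral => //; exact: integrable_nat.
Qed.

Lemma meanB mu f g C : (forall y, `|f y| <= C) -> (forall y, `|g y| <= C) ->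
  mean mu (fun y => f y - g y) = mean mu f - mean mu g.
Proof.
move=> fC gC; apply: RintegralB => //; exact: integrable_nat.
Qed.

Lemma meanD mu f g C : (forall y, `|f y| <= C) -> (forall y, `|g y| <= C) ->
  mean mu (fun y => f y + g y) = mean mu f + mean mu g.
Proof.
move=> fC gC; apply: RintegralD => //; exact: integrable_nat.
Qed.

Lemma meanZ mu f C c : (forall y, `|f y| <= C) ->
  mean mu (fun y => c * f y) = c * mean mu f.
Proof. by move=> fC; apply: RintegralZl => //; exact: integrable_nat. Qed.

Lemma mean01 mu f : (forall y, 0 <= f y <= 1) -> 0 <= mean mu f <= 1.
Proof.
move=> f1; apply/andP; split; first by apply: Rintegral_ge0 => y _; case/andP: (f1 y).
rewrite (_ : 1 = mean mu (cst 1)).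
  apply: (@le_mean _ _ _ 1) => y; last by case/andP: (f1 y).
    by have /andP[? ?] := f1 y; rewrite ger0_norm.
  by rewrite normr1.
rewrite /mean Rintegral_cst// mul1r (_ : fine _ = 1)//.
by rewrite -[RHS]/(fine 1%E); congr fine; exact: probability_setT.
Qed.

Lemma mean_atom mu f y C : (forall z, 0 <= f z <= C) ->
  fine (mu [set y]) * f y <= mean mu f.
Proof.
move=> fC; apply: (cvgr_to_ge (@mean_cvg mu _ _ fC)).
near=> n.
have yn : (y < n)%N by near: n; exact: nbhs_infty_gt.
rewrite big_mkord (bigD1 (Ordinal yn))//= lerDl sumr_ge0// => z _.
by rewrite mulr_ge0 ?fine_prob_ge0//; case/andP: (fC z).
Unshelve. all: by end_near. Qed.

Lemma mean_gt0 mu f C : (forall z, 0 <= f z <= C) ->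
  (forall y, mu [set y] != 0%E -> 0 < f y) -> 0 < mean mu f.
Proof.
move=> fC f0.
have [[y my]|noatom] := pselect (exists y, mu [set y] != 0%E).
  apply: lt_le_trans (@mean_atom mu _ y _ fC).
  rewrite mulr_gt0 ?f0// lt_def fine_prob_ge0 andbT.
  by apply: contra my => /eqP my; rewrite -(@fineK _ (mu [set y])) ?fin_num_prob// my.
have /eqP := @probability_setT _ _ _ mu.
have -> : [set: nat] = \bigcup_y [set y].
  by apply/seteqP; split => // y _; exists y.
rewrite measure_semi_bigcup//; last by move=> i j _ _ [x [/= -> ->]].
rewrite eseries0 1?eq_sym ?onee_eq0// => y _ _.
by apply/eqP/negP => /negP my; apply: noatom; exists y.
Qed.

(** Keeping the contribution of a single atom of [mu] is all that a
    minorization by a Dirac mass needs. *)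
Lemma mean_atom_gap mu f g y C : (forall z, f z <= g z) ->
  (forall z, `|f z| <= C) -> (forall z, `|g z| <= C) ->
  mean mu f + fine (mu [set y]) * (g y - f y) <= mean mu g.
Proof.
move=> fg fC gC; rewrite -lerBrDl -(meanB _ gC fC).
apply: (@mean_atom _ (fun z => g z - f z) _ (C + C)) => z.
rewrite subr_ge0 fg/=.
apply: le_trans (ler_norm _) _; apply: le_trans (ler_normB _ _) _.
exact: lerD.
Qed.


End NatProbability.

(** * Closeness on sets and limits of probabilities *)

Section SetwiseApproximation.
Context {R : realType}.
Implicit Types (C c e : R) (mu nu : probability nat R) (f g : nat -> R)
  (A B D : set nat) (v : set nat -> R).

Definition finitely_additive (v : set nat -> R) : Prop :=
  forall A B, A `&` B = set0 -> v (A `|` B) = v A + v B.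

Lemma finitely_additive0 v : finitely_additive v -> v set0 = 0.
Proof.
move=> av; have := av _ _ (set0I set0); rewrite setU0 => /eqP.
by rewrite -subr_eq0 opprD addrA subrr sub0r oppr_eq0 => /eqP.
Qed.

(** The sum is the difference of the values of [v] on the set of points of
    nonnegative mass and on the set of points of negative mass. *)
Lemma sum_atoms_le v e n : finitely_additive v -> (forall A, `|v A| <= e) ->
  \sum_(0 <= y < n) `|v [set y]| <= 2 * e.
Proof.
move=> av ve.
suff [A [B [_ _ ->]]] : exists A B : set nat, [/\ A `<=` `I_n, B `<=` `I_n &
    \sum_(0 <= y < n) `|v [set y]| = v A - v B].
  rewrite mulr_natl mulr2n; apply: le_trans (ler_norm _) _.
  by apply: le_trans (ler_normB _ _) _; exact: lerD.
elim: n => [|n [A [B [An Bn sAB]]]].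
  exists set0, set0; split=> //.
  by rewrite big_geq// finitely_additive0// subr0.
have weak (C : set nat) : C `<=` `I_n -> C `<=` `I_n.+1.
  by move=> Cn y /Cn /= yn; exact: ltnW.
have add (C : set nat) : C `<=` `I_n -> v (C `|` [set n]) = v C + v [set n].
  move=> Cn; apply: av; apply/seteqP; split => // y [/Cn /= + yn].
  by rewrite yn ltnn.
have sub (C : set nat) : C `<=` `I_n -> C `|` [set n] `<=` `I_n.+1.
  by move=> Cn y [/Cn/= yn|/= ->]; [exact: ltnW|].
rewrite big_nat_recr//= sAB; have [vn|vn] := leP 0 (v [set n]).
  exists (A `|` [set n]), B; split; [exact: sub|exact: weak|].
  by rewrite add// ger0_norm// addrAC.
exists A, (B `|` [set n]); split; [exact: weak|exact: sub|].
by rewrite add// ltr0_norm// opprD addrA.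
Qed.

(** [v] need be additive on sets of positive integers only; it is extended by
    ignoring 0. *)
Lemma tv_norm_le v e :
  (forall A B, A `<=` positives -> B `<=` positives -> A `&` B = set0 ->
    v (A `|` B) = v A + v B) ->
  (forall A, A `<=` positives -> `|v A| <= e) ->
  (tv_norm v <= (2 * e)%:E)%E.
Proof.
move=> av ve; pose w A := v (A `&` positives).
have aw : finitely_additive w.
  move=> A B AB; rewrite /w setIUl av//; do ?exact: subIsetr.
  by rewrite setIACA AB set0I.
have we A : `|w A| <= e by apply: ve; exact: subIsetr.
apply: lime_le; first by apply: is_cvg_nneseries => n _ _; rewrite lee_fin.
near=> n; rewrite sumEFin lee_fin.
apply: le_trans (sum_atoms_le n aw we).
have n0 : (0 < n)%N by near: n; exact: nbhs_infty_gt.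
rewrite [leRHS]big_ltn//; apply: ler_wpDl => //.
apply: ler_sum_nat => y /andP[y0 _].
suff -> : w [set y] = v [set y] by [].
by rewrite /w; congr v; apply/seteqP; split => [z []|z /= ->].
Unshelve. all: by end_near. Qed.

(** By [sum_atoms_le], closeness on all sets bounds the sum of the differences
    of the atoms, hence integrals of functions with values in [[0, 1]]. *)
Lemma near_mean mu nu f e : (forall A, `|fine (mu A) - fine (nu A)| <= e) ->
  (forall y, 0 <= f y <= 1) -> `|mean mu f - mean nu f| <= 2 * e.
Proof.
move=> mne f1.
have H : `|\sum_(0 <= y < n) fine (mu [set y]) * f y -
           \sum_(0 <= y < n) fine (nu [set y]) * f y| @[n --> \oo] -->
    `|mean mu f - mean nu f|.
  by apply: cvg_norm; apply: cvgB; exact: mean_cvg f1.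
apply: (cvgr_to_le H); near=> n.
have av : finitely_additive (fun A => fine (mu A) - fine (nu A)).
  by move=> A B AB; rewrite !fine_probU// opprD addrACA.
apply: le_trans (sum_atoms_le n av mne).
rewrite -sumrB; apply: le_trans (ler_norm_sum _ _ _) _.
apply: ler_sum => y _; rewrite -mulrBl normrM ler_piMr//.
by have /andP[? ?] := f1 y; rewrite ger0_norm.
Unshelve. all: by end_near. Qed.

(** Countable additivity is continuity along the partial unions; the error
    [e n] does not depend on the set, so continuity passes to the limit. *)
Lemma setwise_limit (mu : nat -> probability nat R)
    (r : set nat -> R) (e : nat -> R) : e @ \oo --> 0 ->
  (forall n (A : set nat), `|fine (mu n A) - r A| <= e n) ->
  exists rho : probability nat R,
    forall A : set nat, fine (rho A) = r A.
Proof.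
move=> e0 mure; have /cvgrPdist_le e0' := e0.
have cvr (A : set nat) : fine (mu n A) @[n --> \oo] --> r A.
  apply/cvgrPdist_le => eps eps0.
  have := e0' _ eps0; apply: filterS => n en.
  rewrite distrC; apply: le_trans (mure n A) _; apply: le_trans en.
  by rewrite sub0r normrN ler_norm.
have r0 (A : set nat) : 0 <= r A.
  apply: (cvgr_to_ge (cvr A)).
  by near=> n; exact: fine_prob_ge0.
have rT : r setT = 1.
  apply: (cvg_unique _ (cvr setT)) => //.
  rewrite (_ : (fun n => _) = cst 1); first exact: cvg_cst.
  by apply/funext => n; rewrite probability_setT.
have rU (A B : set nat) : A `&` B = set0 ->
    r (A `|` B) = r A + r B.
  move=> AB; apply: (cvg_unique _ (cvr (A `|` B))) => //.
  rewrite (_ : (fun n => _) = (fun n => fine (mu n A) + fine (mu n B))).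
    by apply: cvgD; exact: cvr.
  by apply/funext => n; rewrite fine_probU.
have rset0 : r set0 = 0.
  apply: (cvg_unique _ (cvr set0)) => //.
  rewrite (_ : (fun n => _) = cst 0); first exact: cvg_cst.
  by apply/funext => n; rewrite measure0.
have sigma : semi_sigma_additive (EFin \o r).
  move=> F mF tF mUF.
  pose S n := \big[setU/set0]_(0 <= i < n) F i.
  have SF n : S n `&` F n = set0.
    rewrite /S; apply/seteqP; split => // x [].
    rewrite big_mkord -bigcup_mkord => -[i /= + Fix Fnx] => /[dup] lin.
    by rewrite (tF i n I I) ?ltnn//; exists x.
  have addS (v : set nat -> R) : v set0 = 0 ->
      (forall A B : set nat, A `&` B = set0 ->
        v (A `|` B) = v A + v B) ->
      forall n, \sum_(0 <= i < n) v (F i) = v (S n).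
    move=> v0 vU; elim => [|n IHn]; first by rewrite /S !big_geq.
    by rewrite /S !big_nat_recr//= -/(S n) vU// IHn.
  have muS N : fine (mu N (S n)) @[n --> \oo] --> fine (mu N (\bigcup_n F n)).
    have := @measure_semi_sigma_additive _ _ _ (mu N) F mF tF mUF.
    rewrite -[X in _ --> X -> _]fineK ?fin_num_prob// => /fine_cvg.
    apply: cvg_trans; apply: near_eq_cvg; near=> n.
    rewrite /= -(addS (fun A => fine (mu N A))) ?measure0//; last first.
      by move=> A B AB; rewrite fine_probU.
    by rewrite sum_fine// => i _; rewrite fin_num_prob.
  have : r (S n) @[n --> \oo] --> r (\bigcup_n F n).
    apply/cvgrPdist_le => eps eps0.
    have eps3 : 0 < eps / 3 by rewrite divr_gt0.
    have [N _ /(_ N (leqnn N))/= eN] := e0' _ eps3.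
    have {}eN : e N <= eps / 3.
      by apply: le_trans eN; rewrite sub0r normrN ler_norm.
    have /cvgrPdist_le /(_ _ eps3) := muS N; apply: filterS => n muSn.
    move: muSn (mure N (S n)) (mure N (\bigcup_n F n)).
    rewrite !ler_norml => /andP[? ?] /andP[? ?] /andP[? ?].
    by apply/andP; split; lra.
  have -> : (fun n => \sum_(0 <= i < n) (EFin \o r) (F i))%E = EFin \o (r \o S).
    by apply/funext => n /=; rewrite sumEFin addS.
  by move=> rS; apply: cvg_EFin => //; near=> n.
have m0 : (EFin \o r) set0 = 0%E by rewrite /= rset0.
have mT : (EFin \o r) setT = 1%E by rewrite /= rT.
have r0' A : (0 <= (EFin \o r) A)%E by rewrite lee_fin.
pose M := isMeasure.Build _ _ _ (EFin \o r) m0 r0' sigma.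
pose mu' : measure nat R := HB.pack (EFin \o r) M.
pose N := Measure_isProbability.Build _ _ _ mu' mT.
pose rho : probability nat R := HB.pack (EFin \o r) M N.
by exists rho.
Unshelve. all: by end_near. Qed.

Lemma conditioned_prob d (T : measurableType d) (mu : probability T R)
    (D : set T) : measurable D -> mu D != 0%E ->
  exists nu : probability T R, forall A : set T, measurable A ->
    fine (nu A) = fine (mu (A `&` D)) / fine (mu D).
Proof.
move=> mD D0.
pose muD : measure T R := mrestr mu mD.
have muDT : muD setT = mu D by rewrite -[in RHS](setTI D).
have Dy : mu D == +oo%E = false.
  by apply/negbTE; rewrite lt_eqF// ltey_eq fin_num_prob.
exists (mnormalize muD mu) => A mA.
transitivity (fine (mnormalize muD mu A)); first by [].
have -> : mnormalize muD mu A = (mu (A `&` D) * ((fine (mu D))^-1)%:E)%E.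
  by rewrite /mnormalize muDT (negbTE D0) Dy.
by rewrite fineM ?fin_num_prob//; exact: measurableI.
Qed.

Lemma mean_conditioned mu nu D f C :
  (forall A : set nat, fine (nu A) = fine (mu (A `&` D)) / fine (mu D)) ->
  (forall y, 0 <= f y <= C) -> (forall y, ~ D y -> f y = 0) ->
  mean nu f = mean mu f / fine (mu D).
Proof.
move=> nuE fC fD; apply: (cvg_unique _ (mean_cvg fC)) => //.
have -> : (fun n => \sum_(0 <= y < n) fine (nu [set y]) * f y) =
    (fun n => (\sum_(0 <= y < n) fine (mu [set y]) * f y) / fine (mu D)).
  apply/funext => n; rewrite mulr_suml; apply: eq_bigr => y _.
  have [Dy|/fD ->] := pselect (D y); last by rewrite !mulr0 mul0r.
  rewrite nuE mulrAC; congr (fine (mu _) * _ / _).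
  by apply/seteqP; split => [z []|z /= ->].
by apply: cvgMl; exact: mean_cvg fC.
Qed.

End SetwiseApproximation.

(** * Quasi-stationary law of a semigroup with a Doeblin minorization *)

Section Doeblin.
Context {R : realType} (Q : R -> nat -> probability nat R) (x0 : nat) (b : R).
Implicit Types (A B : set nat) (mu nu : probability nat R) (m M s t c : R).

Let q t x A : R := fine (Q t x A).
Let h t x : R := q t x positives.

Hypothesis chapman_kolmogorov : forall t s x A, 0 <= t -> 0 <= s ->
  Q (t + s) x A = (\int[Q t x]_y Q s y A)%E.
Hypothesis absorbed : forall t, 0 <= t -> Q t 0%N positives = 0%E.
Hypothesis surviving : forall t x, 0 <= t -> (0 < x)%N -> 0 < h t x.
Hypothesis x0_gt0 : (0 < x0)%N.
Hypothesis b_gt0 : 0 < b.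
Hypothesis doeblin : forall s x, 0 <= s -> (0 < x)%N ->
  b * h (1 + s) x <= q 1 x [set x0] * h s x0.

Lemma kernel01 t x A : 0 <= q t x A <= 1.
Proof. by rewrite fine_prob_ge0 fine_prob_le1. Qed.

Lemma kernel_norm_le1 t x A : `|q t x A| <= 1.
Proof. by have /andP[? ?] := kernel01 t x A; rewrite ger0_norm. Qed.

Lemma kernel_le_survival t x A : A `<=` positives -> q t x A <= h t x.
Proof. by move=> Ap; exact: le_fine_prob. Qed.

Lemma kernel_absorbed t A : 0 <= t -> A `<=` positives -> q t 0%N A = 0.
Proof.
move=> t0 Ap; apply/le_anti/andP; split; last by case/andP: (kernel01 t 0%N A).
by apply: le_trans (kernel_le_survival _ _ Ap) _; rewrite /h /q absorbed.
Qed.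

Lemma kernel_mean t s x A : 0 <= t -> 0 <= s ->
  q (t + s) x A = mean (Q t x) (fun y => q s y A).
Proof.
move=> t0 s0; rewrite /q chapman_kolmogorov//; congr fine.
by apply: eq_integral => y _; rewrite fineK ?fin_num_prob.
Qed.

Lemma le_mean_scaled mu c (f g : nat -> R) y :
  (forall z, `|f z| <= 1) -> (forall z, `|g z| <= 1) ->
  (forall z, c * f z <= g z) ->
  c * mean mu f + fine (mu [set y]) * (g y - c * f y) <= mean mu g.
Proof.
move=> f1 g1 cfg; rewrite -(meanZ _ _ f1).
apply: (@mean_atom_gap _ _ (fun z => c * f z) _ _ (`|c| + 1)) => // z.
  by rewrite normrM ler_wpDr// ler_piMr.
by apply: le_trans (g1 z) _; rewrite lerDr.
Qed.

(** The conditional probability of [A] at time [t] given survival lies in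
    [[m, M]] for every initial state; without the division, the inequalities
    can be integrated over the initial state, and hold trivially at 0. *)
Definition sandwich A m M t := forall x, m * h t x <= q t x A <= M * h t x.

(** The slack of either bound at one atom [y] is kept, for [doeblin_step]. *)
Lemma sandwich_mean mu A m M t y : sandwich A m M t ->
  m * mean mu (h t) + fine (mu [set y]) * (q t y A - m * h t y)
    <= mean mu (fun x => q t x A) /\
  mean mu (fun x => q t x A)
    <= M * mean mu (h t) - fine (mu [set y]) * (M * h t y - q t y A).
Proof.
move=> mM; split.
  apply: le_mean_scaled => z; [exact: kernel_norm_le1|exact: kernel_norm_le1|].
  by case/andP: (mM z).
have qN z : `|-1 * q t z A| <= 1 by rewrite mulN1r normrN kernel_norm_le1.
have := @le_mean_scaled mu (- M) (h t) (fun x => -1 * q t x A) y.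
rewrite (@meanZ _ mu _ 1); last by move=> z; exact: kernel_norm_le1.
move=> /(_ (fun z => kernel_norm_le1 t z positives) qN) H.
suff /H : forall z, - M * h t z <= -1 * q t z A by rewrite mulN1r; lra.
by move=> z; have /andP[_] := mM z; lra.
Qed.

Lemma sandwich_later A m M s t : 0 <= s -> 0 <= t ->
  sandwich A m M s -> sandwich A m M (t + s).
Proof.
move=> s0 t0 mM x; have [L U] := sandwich_mean (Q t x) 0 mM.
rewrite /h !kernel_mean// -/(h s); have /andP[mq qM] := mM 0%N.
have p0 : 0 <= fine (Q t x [set 0%N]) by exact: fine_prob_ge0.
apply/andP; split.
  apply: le_trans L; rewrite lerDl mulr_ge0// subr_ge0//.
apply: le_trans U _; rewrite lerBlDr lerDl mulr_ge0// subr_ge0//.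
Qed.

(** After the first unit of time the conditioned path is at [x0] with weight at
    least [b], and there the conditional probability is the number [u]; the
    bounds move towards [u] by the proportion [b]. *)
Lemma doeblin_step A m M s : 0 <= s -> A `<=` positives -> sandwich A m M s ->
  exists m' M', M' - m' = (1 - b) * (M - m) /\ sandwich A m' M' (1 + s).
Proof.
move=> s0 Ap mM.
have h0 : 0 < h s x0 by exact: surviving.
pose u := q s x0 A / h s x0.
have uE : q s x0 A = u * h s x0 by rewrite /u mulfVK// gt_eqF.
have /andP[mu uM] : m <= u <= M.
  by have := mM x0; rewrite uE !ler_pM2r.
exists (m + b * (u - m)), (M - b * (M - u)); split; first by ring.
move=> [|x]; first by rewrite /h !kernel_absorbed ?addr_ge0// !mulr0 lexx.
have [L U] := sandwich_mean (Q 1 x.+1) x0 mM.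
have D := doeblin s0 (ltn0Sn x).
move: L U D; rewrite /h !kernel_mean// -/(h s) -/(h s x0) uE -/(q 1 x.+1 [set x0]).
set p := q 1 _ _; set H := mean _ _; set G := mean _ _ => L U D.
have Dm : b * H * (u - m) <= p * h s x0 * (u - m).
  by rewrite ler_wpM2r// subr_ge0.
have DM : b * H * (M - u) <= p * h s x0 * (M - u).
  by rewrite ler_wpM2r// subr_ge0.
apply/andP; split; lra.
Qed.

(** The case [s = 0], [x = x0] of the minorization. *)
Lemma minorization_le1 : b <= 1.
Proof.
have D := @doeblin 0 x0 (lexx 0) x0_gt0.
have h1 : 0 < h (1 + 0) x0 by apply: surviving; rewrite ?addr0.
rewrite -(ler_pM2r h1) mul1r; apply: le_trans D _.
rewrite /h kernel_mean//; apply: (@mean_atom _ _ (fun y => q 0 y positives) _ 1).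
by move=> z; exact: kernel01.
Qed.

Lemma sandwich_contracts A n s : 0 <= s -> A `<=` positives ->
  exists m M, M - m <= (1 - b) ^+ n /\ sandwich A m M (n%:R + s).
Proof.
move=> s0 Ap; elim: n => [|n [m [M [Mm mM]]]].
  exists 0, 1; rewrite subr0 expr0 add0r; split => // x.
  by rewrite mul0r mul1r kernel_le_survival// andbT; case/andP: (kernel01 s x A).
have [m' [M' [E S]]] := doeblin_step (addr_ge0 (ler0n _ n) s0) Ap mM.
exists m', M'; split.
  by rewrite E exprS ler_wpM2l// subr_ge0 minorization_le1.
by rewrite -natr1 [n%:R + 1]addrC -addrA.
Qed.

Lemma sandwich_at A t : 0 <= t -> A `<=` positives ->
  exists m M, M - m <= (1 - b) ^+ Num.truncn t /\
    forall s, t <= s -> sandwich A m M s.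
Proof.
move=> t0 Ap; have /andP[+ _] := truncn_itv t0; rewrite -subr_ge0 => tt.
have [m [M [Mm mM]]] := sandwich_contracts (Num.truncn t) tt Ap.
exists m, M; split => // s ts; rewrite -(subrK t s).
apply: sandwich_later; rewrite ?subr_ge0//.
by move: mM; rewrite addrC subrK.
Qed.

Lemma geom_eq0 (a : R) : (forall n, `|a| <= (1 - b) ^+ n) -> a = 0.
Proof.
move=> ab; apply/eqP; rewrite -normr_le0.
have b1 : `|1 - b| < 1.
  by rewrite ger0_norm ?subr_ge0 ?minorization_le1// ltrBlDr ltrDl.
apply: (cvgr_to_ge (cvg_expr b1)).
by near=> n; exact: ab.
Unshelve. all: by end_near. Qed.

(* [r A] is the lower limit of [u A]: it is defined before convergence is
   known, and it lies between any bounds that [u A] eventually satisfies. *)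
Let u A t : R := q t x0 (A `&` positives) / h t x0.
Let r A : R := sup [set m | exists2 t, 0 <= t & forall s, t <= s -> m <= u A s].

Lemma limit_between A m M t : 0 <= t ->
  (forall s, t <= s -> m <= u A s <= M) -> m <= r A <= M.
Proof.
move=> t0 umM; rewrite /r; set E := [set _ | _].
have Em : E m by exists t => // s /umM /andP[].
have EM : ubound E M.
  move=> c [t' t'0 cu].
  have tT : t <= Num.max t t' by rewrite le_max lexx.
  apply: le_trans (cu (Num.max t t') _) _; first by rewrite le_max lexx orbT.
  by case/andP: (umM _ tT).
apply/andP; split; first by apply: ub_le_sup => //; exists M.
by apply: ge_sup => //; exists m.
Qed.

Lemma mean_survival_gt0 mu t : 0 <= t -> mu [set 0%N] = 0%E ->
  0 < mean mu (h t).
Proof.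
move=> t0 mu0; apply: (@mean_gt0 _ _ _ 1) => [z|[|z]]; first exact: kernel01.
  by rewrite mu0 eqxx.
by move=> _; exact: surviving.
Qed.

(** The bounds of [sandwich_at] hold for all initial states and all later
    times, hence for [mu] and, as [t] grows, for [r A]. *)
Lemma conditioned_near mu A s t : 0 <= t -> t <= s -> A `<=` positives ->
  mu [set 0%N] = 0%E ->
  `|mean mu (fun x => q s x A) / mean mu (h s) - r A| <= (1 - b) ^+ Num.truncn t.
Proof.
move=> t0 ts Ap mu0; have [m [M [Mm mM]]] := sandwich_at t0 Ap.
have s0 : 0 <= s by exact: le_trans ts.
have h0 := mean_survival_gt0 s0 mu0.
have /andP[mr rM] : m <= r A <= M.
  apply: (limit_between t0) => s' ts'; rewrite /u setIidl//.
  by rewrite ler_pdivlMr ?ler_pdivrMr ?surviving ?(le_trans t0 ts')//; exact: mM.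
have [L U] := sandwich_mean mu 0 (mM s ts).
rewrite mu0 /= mul0r addr0 -ler_pdivlMr// in L.
rewrite mu0 /= mul0r subr0 -ler_pdivrMr// in U.
apply: le_trans Mm; rewrite ler_norml; apply/andP; split; lra.
Qed.

Let near A t s : 0 <= t -> t <= s ->
  `|u A s - r A| <= (1 - b) ^+ Num.truncn t.
Proof.
move=> t0 ts; have Ap : A `&` positives `<=` positives by exact: subIsetr.
have [m [M [Mm mM]]] := sandwich_at t0 Ap.
have umM s' : t <= s' -> m <= u A s' <= M.
  move=> ts'; have hs := surviving (le_trans t0 ts') x0_gt0.
  by rewrite /u ler_pdivlMr// ler_pdivrMr//; exact: mM.
have /andP[? ?] := limit_between t0 umM; have /andP[? ?] := umM s ts.
by apply: le_trans Mm; rewrite ler_norml; apply/andP; split; lra.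
Qed.

(** The limit law is approached along the conditioned laws [nu n] of the process
    started at [x0].  For invariance, the semigroup identity gives
    [mean (nu n) (q t A) = u A (n + t) * mean (nu n) (h t)]; each of the three
    quantities is within a multiple of [(1 - b) ^ n] of its limit. *)
Theorem qsd_of_doeblin : exists rho : probability nat R,
  [/\ rho [set 0%N] = 0%E,
      forall t A, 0 <= t -> A `<=` positives ->
        mean rho (fun x => q t x A) = fine (rho A) * mean rho (h t),
      forall nu, nu [set 0%N] = 0%E ->
        (forall t A, 0 <= t -> A `<=` positives ->
          mean nu (fun x => q t x A) = fine (nu A) * mean nu (h t)) ->
        forall A, A `<=` positives -> fine (nu A) = fine (rho A)
    & forall mu t A, mu [set 0%N] = 0%E -> 0 <= t -> A `<=` positives ->
        `|mean mu (fun x => q t x A) / mean mu (h t) - fine (rho A)|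
          <= (1 - b) ^+ Num.truncn t].
Proof.
have hn n : 0 < h n%:R x0 by exact: surviving.
have hQ n : Q n%:R x0 positives != 0%E.
  by apply/eqP => Q0; have := hn n; rewrite /h /q Q0 ltxx.
have mpos : measurable positives by [].
pose nu n : probability nat R := sval (cid (conditioned_prob mpos (hQ n))).
have nuE n A : fine (nu n A) = u A n%:R.
  by rewrite /nu; case: cid => /= ? ->.
have near_nu n A : `|fine (nu n A) - r A| <= (1 - b) ^+ n.
  by rewrite nuE -[n in leRHS](@natrK R); exact: near.
have b1 : `|1 - b| < 1.
  by rewrite ger0_norm ?subr_ge0 ?minorization_le1// ltrBlDr ltrDl.
have [rho rhoE] := setwise_limit (cvg_expr b1) near_nu.
exists rho; split.
- rewrite -[LHS]fineK ?fin_num_prob//; congr (_%:E).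
  apply: geom_eq0 => n; rewrite rhoE -normrN -sub0r.
  suff <- : fine (nu n [set 0%N]) = 0 by exact: near_nu.
  rewrite nuE /u (_ : _ `&` _ = set0) /q ?measure0 ?mul0r//.
  by apply/seteqP; split => // z [/= ->].
- move=> t A t0 Ap; pose f y := q t y A; apply/eqP; rewrite -subr_eq0; apply/eqP.
  have meanE n B : B `<=` positives ->
      mean (nu n) (fun y => q t y B) = q (n%:R + t) x0 B / h n%:R x0.
    move=> Bp; rewrite kernel_mean//; apply: mean_conditioned (kernel01 t ^~ B) _.
      by move=> C; exact: nuE.
    by move=> [|y] yp; [exact: kernel_absorbed|case: yp].
  have rA : 0 <= r A by rewrite -rhoE fine_prob_ge0.
  have rA1 : r A <= 1 by rewrite -rhoE fine_prob_le1.
  (* 2 + 1 + 2: the errors on [mean (nu n) f], on [u A] and on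
     [mean (nu n) (h t)] *)
  suff : (mean rho f - fine (rho A) * mean rho (h t)) / 5 = 0.
    by move=> /eqP; rewrite mulf_eq0 invr_eq0 pnatr_eq0 orbF => /eqP.
  apply: geom_eq0 => n; rewrite normrM [`|_^-1|]ger0_norm// ler_pdivrMr//.
  have close B : `|mean (nu n) (fun y => q t y B) - mean rho (fun y => q t y B)|
      <= 2 * (1 - b) ^+ n.
    by apply: near_mean => [C|y]; [rewrite rhoE|exact: kernel01].
  have nt : n%:R <= n%:R + t by rewrite lerDl.
  have Ur := near A (ler0n _ n) nt; rewrite natrK in Ur.
  pose w := h (n%:R + t) x0 / h n%:R x0.
  have wH : `|w - mean rho (h t)| <= 2 * (1 - b) ^+ n.
    by have := close positives; rewrite meanE.
  have UF : `|u A (n%:R + t) * w - mean rho f| <= 2 * (1 - b) ^+ n.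
    have := close A; rewrite meanE//.
    have -> : q (n%:R + t) x0 A = u A (n%:R + t) * h (n%:R + t) x0.
      by rewrite /u setIidl// mulfVK// gt_eqF// surviving// addr_ge0.
    by rewrite -mulrA.
  have w01 : `|w| <= 1.
    have /andP[? ?] := mean01 (nu n) (kernel01 t ^~ positives).
    by rewrite /w -meanE// ger0_norm.
  have -> : mean rho f - fine (rho A) * mean rho (h t) =
     - (u A (n%:R + t) * w - mean rho f) + (u A (n%:R + t) - r A) * w
     + r A * (w - mean rho (h t)) by rewrite rhoE; ring.
  apply: le_trans (ler_normD _ _) _; apply: le_trans (lerD (ler_normD _ _) (lexx _)) _.
  rewrite normrN (normrM _ w) (normrM (r A)) [`|r A|]ger0_norm//.
  have : `|u A (n%:R + t) - r A| * `|w| <= `|u A (n%:R + t) - r A| by rewrite ler_piMr.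
  have : r A * `|w - mean rho (h t)| <= `|w - mean rho (h t)| by rewrite ler_piMl.
  lra.
- move=> mu mu0 qsd A Ap; apply/eqP; rewrite -subr_eq0; apply/eqP.
  apply: geom_eq0 => n; have n0 := ler0n R n.
  have := conditioned_near n0 (lexx _) Ap mu0.
  by rewrite qsd// mulfK ?natrK ?rhoE// gt_eqF// mean_survival_gt0.
- by move=> mu t A mu0 t0 Ap; rewrite rhoE; exact: conditioned_near.
Qed.

End Doeblin.

(** * Almost sure comparison of events *)

Section AlmostSure.
Context d (T : measurableType d) (R : realType) (mu : measure T R).

Lemma ae_le_measure (A B : set T) : measurable A -> measurable B ->
  {ae mu, forall w, A w -> B w} -> (mu A <= mu B)%E.
Proof.
move=> mA mB [N [mN N0 AN]].
have AB : A `<=` B `|` N.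
  move=> w Aw; have [Bw|nB] := pselect (B w); [by left|right].
  by apply: AN => /(_ Aw).
rewrite -(measureU0 mB mN N0).
by apply: le_measure; rewrite ?inE//; exact: measurableU.
Qed.

Lemma ae_eq_measure (A B : set T) : measurable A -> measurable B ->
  {ae mu, forall w, A w <-> B w} -> mu A = mu B.
Proof.
move=> mA mB [N [mN N0 AN]]; apply/le_anti/andP; split;
  apply: ae_le_measure => //; exists N; split => // w H; apply: AN => H'; apply: H.
  by move=> /H'.
by move=> /H'.
Qed.

End AlmostSure.

(** * Paths, histories and absorption *)

Section Paths.
Context (R : realType) (d : measure_display) (Omega : measurableType d)
  (X : R -> Omega -> nat) (P : nat -> probability Omega R).
Hypothesis markovX : is_markov_process X P.
Implicit Types (s t u : R) (B : set nat) (w : Omega) (x y : nat).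

Definition hit B s : set Omega :=
  [set w | exists u, [/\ 0 <= u, u <= s & B (X u w)]].

Lemma right_constant w t : 0 <= t ->
  exists2 e, 0 < e & forall u, t <= u -> u < t + e -> X u w = X t w.
Proof.
move=> t0; have [e /= e0 He] := mp_right_continuous markovX w t0.
exists e => // u; rewrite le_eqVlt => /predU1P[<-//|tu ute].
by apply: He => //=; rewrite ltr0_norm ?subr_lt0//; lra.
Qed.

(** By right-continuity the infimum defining a hitting time is attained. *)
Lemma hitting_time_leP B w s : (hitting_time X B w <= s%:E)%E <-> hit B s w.
Proof.
split=> [Ts|[u [u0 us Bu]]]; last first.
  apply: (@le_trans _ _ u%:E); last by rewrite lee_fin.
  by apply: ereal_inf_lbound; exists u.
set S := [set t : R | 0 <= t /\ B (X t w)].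
have S0 : S !=set0.
  have /ereal_inf_ltP[_ [u [u0 Bu] <-] _] := le_lt_trans Ts (ltry s).
  by exists u.
have Slb : lbound S 0 by move=> u [].
have iS : has_inf S by split => //; exists 0.
have i0 : 0 <= inf S by apply: lb_le_inf.
have [e e0 Xe] := right_constant w i0.
have [u Su ue] := inf_adherent e0 iS.
have iu : inf S <= u by apply: inf_lbound => //; exists 0.
have Bi : B (X (inf S) w) by rewrite -(Xe u)//; case: Su.
exists (inf S); split => //.
rewrite -lee_fin; apply: le_trans Ts.
apply/ereal_infP => _ [v Sv <-]; rewrite lee_fin.
by apply: inf_lbound => //; exists 0.
Qed.

Lemma history_sub t (A : set Omega) : history X t A ->
  0 <= t -> measurable A.
Proof.
move=> hA t0; apply: (smallest_sub _ _ hA).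
  exact: sigma_algebra_measurable.
move=> _ [u [B [u0 ut ->]]].
by rewrite -[_ @^-1` _]setTI; exact: (mp_measurable markovX).
Qed.

Lemma measurable_preX t B : 0 <= t -> measurable (X t @^-1` B).
Proof.
by move=> t0; rewrite -[_ @^-1` _]setTI; exact: (mp_measurable markovX).
Qed.

(* The history as the measurable sets of a type, so that lemmas on measurable
   sets apply to it. *)
Let H t := g_sigma_algebraType [set A : set Omega | exists u, exists B : set nat,
        [/\ 0 <= u, u <= t & A = X u @^-1` B] ].

Lemma historyE t (A : set Omega) : history X t A = measurable (A : set (H t)).
Proof. by []. Qed.

Lemma history_preX t u B : 0 <= u -> u <= t -> history X t (X u @^-1` B).
Proof. by move=> u0 ut; apply: sub_sigma_algebra; exists u, B. Qed.

(** A right-continuous path that hits [B] before time [s] is in [B] at time [s]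
    or at some rational time before [s]. *)
Lemma history_hit B s t : s <= t -> history X t (hit B s).
Proof.
move=> st; have [s0|s0] := ltP s 0.
  suff -> : hit B s = set0 by rewrite historyE; exact: measurable0.
  by apply/seteqP; split => // w [u [u0 us _]]; lra.
pose F (q : rat) : set Omega :=
  if (0 <= ratr q :> R) && (ratr q < s) then X (ratr q) @^-1` B else set0.
have -> : hit B s = (X s @^-1` B) `|` \bigcup_q F q.
  apply/seteqP; split => [w [u [u0 us Bu]]|w [Bs|[q _]]]; first last.
  - rewrite /F; case: ifPn => // /andP[q0 qs] Bq.
    by exists (ratr q); split => //; exact: ltW.
  - by exists s; split.
  have [<-|us'] := eqVneq u s; first by left.
  have {us us'} us : u < s by rewrite lt_neqAle us'.
  have [e e0 Xe] := right_constant w u0.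
  have [q] : exists q : rat, ratr q \in `]u, Num.min s (u + e)[.
    by apply: rat_in_itvoo; rewrite lt_min us ltrDl.
  rewrite in_itv/= lt_min => /andP[uq /andP[qs qe]].
  right; exists q => //; rewrite /F (le_trans u0 (ltW uq)) qs/=.
  by rewrite /= Xe// ltW.
rewrite historyE; apply: measurableU; first by rewrite -historyE; exact: history_preX.
apply: bigcupT_measurable_rat => q; rewrite /F; case: ifPn => [/andP[q0 qs]|_].
  by rewrite -historyE; apply: history_preX => //; exact: le_trans (ltW qs) st.
exact: measurable0.
Qed.

Lemma measurable_hit B s : measurable (hit B s).
Proof.
have H1 := history_hit B (lexx s).
have [s0|s0] := ltP s 0.
  suff -> : hit B s = set0 by exact: measurable0.
  by apply/seteqP; split => // w [u [u0 us _]]; lra.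
exact: history_sub H1 s0.
Qed.

(** The Markov property at the fixed time [s], summed over the position. *)
Lemma markov_series x s u (A : set Omega) B : 0 <= s -> 0 <= u ->
  history X s A ->
  P x (A `&` X (s + u) @^-1` B) =
  (\sum_(0 <= y <oo) P x (A `&` X s @^-1` [set y]) * P y (X u @^-1` B))%E.
Proof.
move=> s0 u0 hA; have mA := history_sub hA s0.
under eq_eseriesr => y _ do rewrite -(mp_markov markovX)//.
have mF y : measurable (A `&` X s @^-1` [set y] `&` X (s + u) @^-1` B).
  by do ?apply: measurableI => //; apply: measurable_preX => //; exact: addr_ge0.
rewrite -(measure_semi_bigcup _ mF); first last.
- exact: bigcupT_measurable.
- by move=> y z _ _ [w [[[_ /= <-] _] [[_ /= <-] _]]].
congr (P x _); apply/seteqP; split => [w [Aw Bw]|w [y _ [[Aw _] Bw]]] //.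
by exists (X s w).
Qed.

Lemma prob_series x s (A : set Omega) : 0 <= s -> history X s A ->
  P x A = (\sum_(0 <= y <oo) P x (A `&` X s @^-1` [set y]))%E.
Proof.
move=> s0 hA; have := markov_series x setT s0 (lexx 0) hA.
rewrite preimage_setT setIT => ->; apply: eq_eseriesr => y _.
by rewrite preimage_setT probability_setT mule1.
Qed.

Lemma markov_le x s u (A : set Omega) B (D : set nat) (c : R) :
  0 <= s -> 0 <= u -> history X s A -> A `<=` X s @^-1` D ->
  (forall y, D y -> (P y (X u @^-1` B) <= c%:E)%E) ->
  (P x (A `&` X (s + u) @^-1` B) <= c%:E * P x A)%E.
Proof.
move=> s0 u0 hA AD Pc; have mA := history_sub hA s0.
have [[y Dy]|D0] := pselect (exists y, D y); last first.
  have -> : A = set0 by apply/seteqP; split => // w /AD Dw; apply: D0; exists (X s w).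
  by rewrite set0I measure0 mule0.
have c0 : 0 <= c by rewrite -lee_fin; exact: le_trans (Pc y Dy).
rewrite markov_series// (prob_series x s0 hA) -nneseriesZl//.
apply: lee_nneseries => [y' _ _|y' _]; first exact: mule_ge0.
have [Dy'|Dy'] := pselect (D y'); first by rewrite muleC lee_wpmul2r// Pc.
suff -> : A `&` X s @^-1` [set y'] = set0 by rewrite measure0 mul0e mule0.
by apply/seteqP; split => // w [/AD + /= Xw]; rewrite /preimage/= Xw.
Qed.

Lemma markov_ge x s u (A : set Omega) B (D : set nat) (c : R) :
  0 <= s -> 0 <= u -> history X s A -> A `<=` X s @^-1` D -> 0 <= c ->
  (forall y, D y -> (c%:E <= P y (X u @^-1` B))%E) ->
  (c%:E * P x A <= P x (A `&` X (s + u) @^-1` B))%E.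
Proof.
move=> s0 u0 hA AD c0 Pc.
rewrite markov_series// (prob_series x s0 hA) -nneseriesZl//.
apply: lee_nneseries => [y _ _|y _]; first exact: mule_ge0.
have [Dy|Dy] := pselect (D y); first by rewrite muleC lee_wpmul2l// Pc.
suff -> : A `&` X s @^-1` [set y] = set0 by rewrite measure0 mul0e mule0.
by apply/seteqP; split => // w [/AD + /= Xw]; rewrite /preimage/= Xw.
Qed.

Lemma ae_start x : {ae P x, forall w, X 0 w = x}.
Proof.
exists (~` (X 0 @^-1` [set x])); split => //.
- by apply: measurableC; exact: measurable_preX.
- by rewrite probability_setC ?(mp_start markovX) ?subee//; exact: measurable_preX.
Qed.

Hypothesis absorbX : zero_absorbing X P.

Lemma survivalE t : survival X t = ~` hit [set 0%N] t.
Proof.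
apply/seteqP; split => w; rewrite /survival /=.
  by move=> Tt /hitting_time_leP; rewrite leNgt Tt.
by move=> nh; rewrite ltNge; apply/negP => /hitting_time_leP.
Qed.

Lemma measurable_survival t : measurable (survival X t).
Proof. by rewrite survivalE; apply: measurableC; exact: measurable_hit. Qed.

Lemma survival_pos t w : 0 <= t -> survival X t w -> (0 < X t w)%N.
Proof.
move=> t0; rewrite survivalE => nh; rewrite lt0n; apply/negP => /eqP Xt0.
by apply: nh; exists t.
Qed.

Lemma absorbed_survival w t :
  (forall t, (extinction_time X w <= t%:E)%E -> X t w = 0%N) ->
  (0 < X t w)%N -> survival X t w.
Proof.
move=> abs; rewrite /survival/= ltNge lt0n => /negP Xt; apply/negP => /abs Xt0.
by rewrite Xt0 eqxx in Xt.
Qed.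

(** Almost surely, being in a positive state at time [t] is the same as being
    alive at time [t]; from here on survival is an event about [X t] alone. *)
Lemma prob_alive x t (A : set nat) : 0 <= t -> A `<=` positives ->
  P x (X t @^-1` A `&` survival X t) = P x (X t @^-1` A).
Proof.
move=> t0 Ap; apply: ae_eq_measure.
- by apply: measurableI; [exact: measurable_preX|exact: measurable_survival].
- exact: measurable_preX.
apply: filterS (absorbX x) => w abs; split => [[]//|Aw]; split => //.
by apply: absorbed_survival => //; exact: Ap.
Qed.

Lemma prob_survival x t : 0 <= t ->
  P x (survival X t) = P x (X t @^-1` positives).
Proof.
move=> t0; rewrite -prob_alive//; congr (P x _); apply/seteqP; split => w [] //.
by move=> St; split => //; exact: survival_pos.
Qed.

Lemma prob_dead t : 0 <= t -> P 0%N (X t @^-1` positives) = 0%E.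
Proof.
move=> t0; rewrite -(@measure0 _ _ _ (P 0%N)); apply: ae_eq_measure => //.
  exact: measurable_preX.
apply: filterS2 (absorbX 0%N) (ae_start 0%N) => w abs X0; split => //.
have /abs Xt : (extinction_time X w <= t%:E)%E.
  by apply/hitting_time_leP; exists 0.
by rewrite /preimage /positives/= Xt.
Qed.

End Paths.

(** * Domination of the survival probabilities *)

Section Domination.
Context (R : realType) (d : measure_display) (Omega : measurableType d)
  (X : R -> Omega -> nat) (P : nat -> probability Omega R).
Hypothesis markovX : is_markov_process X P.
Hypothesis absorbX : zero_absorbing X P.
Context (K : set nat) (x0 : nat) (lambda0 c1 c2 c3 : R).
Hypothesis Kpos : K `<=` positives.
Hypothesis lambda0_gt0 : 0 < lambda0.
Hypothesis c1_gt0 : 0 < c1.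
Hypothesis c2_gt0 : 0 < c2.
Hypothesis c3_gt0 : 0 < c3.
Implicit Types (s t u : R) (w : Omega) (x y : nat).

Let h t y : R := fine (P y (X t @^-1` positives)).
Let T w : \bar R := mine (hitting_time X K w) (extinction_time X w).
Let Phi w : \bar R := expeR (lambda0%:E * T w).

Hypothesis harnack : forall t y z, 0 <= t -> K y -> K z -> c1 * h t y <= h t z.
Hypothesis return_moment : forall x, (0 < x)%N -> (\int[P x]_w Phi w <= c2%:E)%E.
Hypothesis stay : forall t, 0 <= t ->
  ((c3 * expR (- lambda0 * t))%:E <= P x0 (X t @^-1` K))%E.

Let alive_fin t y : 0 <= t -> P y (X t @^-1` positives) \is a fin_num.
Proof. by move=> t0; apply: fin_num_prob; exact: (measurable_preX markovX). Qed.

(** From [x0], wait in [K] until time [s], then survive as from [y]. *)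
Lemma alive_from_K s t y : 0 <= s -> s <= t -> K y ->
  c1 * c3 * expR (- lambda0 * s) * h (t - s) y <= h t x0.
Proof.
move=> s0 st Ky; have t0 : 0 <= t by exact: le_trans st.
have ts0 : 0 <= t - s by rewrite subr_ge0.
have hy : 0 <= c1 * h (t - s) y by rewrite mulr_ge0 ?fine_prob_ge0// ltW.
have hA : history X s (X s @^-1` K) by exact: history_preX.
have H : ((c1 * h (t - s) y)%:E * P x0 (X s @^-1` K) <=
    P x0 (X s @^-1` K `&` X t @^-1` positives))%E.
  rewrite -[t in leRHS](subrKC s).
  apply: (@markov_ge _ _ _ _ _ markovX x0 s _ _ _ K) => // z Kz.
  by rewrite -[leRHS]fineK ?alive_fin// lee_fin harnack.
rewrite -lee_fin -/(h t x0) fineK ?alive_fin//.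
apply: le_trans (le_trans H _); last first.
  by apply: le_measure; rewrite ?inE;
    [apply: measurableI; exact: (measurable_preX markovX)
    |exact: (measurable_preX markovX)|move=> w []].
rewrite (_ : c1 * _ * _ * _ = (c1 * h (t - s) y) * (c3 * expR (- lambda0 * s))).
  by rewrite EFinM lee_wpmul2l ?lee_fin// stay.
by ring.
Qed.

Lemma T_le w s : (T w <= s%:E)%E <-> hit X (K `|` [set 0%N]) s w.
Proof.
rewrite /T ge_min; split=> [/orP[|]|[u [u0 us [Ku|Xu0]]]].
- by move=> /(hitting_time_leP markovX)[u [u0 us Ku]]; exists u; split => //; left.
- by move=> /(hitting_time_leP markovX)[u [u0 us Ku]]; exists u; split => //; right.
- by apply/orP; left; apply/(hitting_time_leP markovX); exists u.
- by apply/orP; right; apply/(hitting_time_leP markovX); exists u.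
Qed.

Lemma measurable_T : measurable_fun [set: Omega] T.
Proof.
apply: (measurability _ (ErealGenOInfty.measurableE R)) => // _ [_ [r ->] <-].
rewrite setTI (_ : _ @^-1` _ = ~` hit X (K `|` [set 0%N]) r).
  by apply: measurableC; exact: (measurable_hit markovX).
apply/seteqP; split => w /=; rewrite in_itv/= andbT.
  by move=> rT /T_le /(lt_le_trans rT); rewrite ltxx.
by move=> nT; rewrite ltNge; apply/negP => /T_le.
Qed.

Lemma measurable_Phi : measurable_fun [set: Omega] Phi.
Proof.
have mT : measurable_fun [set: Omega] (fun w => lambda0%:E * T w)%E.
  by apply: measurable_funeM; exact: measurable_T.
apply: (measurability _ (ErealGenOInfty.measurableE R)) => // _ [_ [r ->] <-].
rewrite setTI; have [r0|r0] := ltP r 0.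
  rewrite (_ : _ @^-1` _ = setT)//; apply/seteqP; split => // w _ /=.
  by rewrite in_itv/= andbT (lt_le_trans _ (expeR_ge0 _))// lte_fin.
have [y yr] := @expeR_total _ r%:E r0.
rewrite (_ : _ @^-1` _ = setT `&` [set w | (y < lambda0%:E * T w)%E]).
  exact: emeasurable_fun_o_infty.
by rewrite setTI; apply/seteqP; split => w /=; rewrite in_itv/= andbT -yr lte_expeR.
Qed.

Let Phi_ge0 w : (0 <= Phi w)%E. Proof. exact: expeR_ge0. Qed.

(** Chebyshev's inequality, localized to [D] so that it can be summed over
    disjoint events. *)
Lemma exp_moment_ge x s (D : set Omega) : measurable D ->
  (forall w, D w -> (s%:E <= T w)%E) ->
  ((expR (lambda0 * s))%:E * P x D <= \int[P x]_(w in D) Phi w)%E.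
Proof.
move=> mD sT; rewrite -integral_cst//; apply: ge0_le_integral => //.
- by move=> w _; rewrite lee_fin expR_ge0.
- exact: measurable_funS measurable_Phi.
- move=> w Dw /=; rewrite -[(expR _)%:E]/(expeR (lambda0 * s)%:E) lee_expeR EFinM.
  by rewrite lee_pmul2l// sT.
Qed.

Lemma moment_le x (D : set Omega) : (0 < x)%N -> measurable D ->
  (\int[P x]_(w in D) Phi w <= c2%:E)%E.
Proof.
move=> x_gt0 mD; apply: le_trans (return_moment x_gt0).
by apply: ge0_subset_integral => //; exact: measurable_Phi.
Qed.

Lemma late_return x t : (0 < x)%N -> 0 <= t ->
  (P x [set w | (t%:E < T w)%E] <= (c2 / c3 * h t x0)%:E)%E.
Proof.
move=> x_gt0 t0; have mD : measurable [set w | (t%:E < T w)%E].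
  by rewrite -[X in measurable X]setTI; exact: emeasurable_fun_o_infty measurable_T _.
have := le_trans (exp_moment_ge x mD (fun w Dw => ltW Dw)) (moment_le x_gt0 mD).
rewrite -[P x _]fineK ?fin_num_prob// -EFinM !lee_fin.
rewrite mulrC -ler_pdivlMr ?expR_gt0// -expRN -mulNr => H.
apply: le_trans H _; rewrite -mulrA ler_pM2l// ler_pdivlMl//.
rewrite -lee_fin /h fineK ?alive_fin//; apply: le_trans (stay t0) _.
apply: le_measure; rewrite ?inE//; last exact: preimage_subset.
  exact: (measurable_preX markovX).
exact: (measurable_preX markovX).
Qed.

(* [T] is the hitting time of [K0]. *)
Let K0 := K `|` [set 0%N].

(* Points of mesh [1 / (n + 1)], stopped at [t].  The first one is negative, so
   that the first interval contains the time 0. *)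
Let grid t n k : R := Num.min ((k%:R - 1) / n.+1%:R) t.

(* [T] lies between two successive grid points, and the path is in [K] at the
   second one: an event of the history at that point. *)
Let cell t n k : set Omega :=
  (hit X K0 (grid t n k.+1) `\` hit X K0 (grid t n k))
    `&` X (grid t n k.+1) @^-1` K.

Let grid_ge0 t n k : 0 <= t -> 0 <= grid t n k.+1.
Proof.
by move=> t0; rewrite le_min t0 andbT divr_ge0// -natr1 addrK.
Qed.

Let grid_le t n k : grid t n k <= t. Proof. by rewrite ge_min lexx orbT. Qed.

Let grid_homo t n j k : (j <= k)%N -> grid t n j <= grid t n k.
Proof.
move=> jk; rewrite le_min grid_le andbT ge_min; apply/orP; left.
by rewrite ler_pM2r ?invr_gt0// lerD2r ler_nat.
Qed.

Let grid_step t n k : grid t n k.+1 - n.+1%:R^-1 <= grid t n k.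
Proof.
rewrite le_min; apply/andP; split.
  by rewrite mulrBl mul1r lerD2r ge_min -natr1 addrK lexx.
by apply: le_trans (grid_le t n k.+1); rewrite gerBl.
Qed.

Let cell_history t n k : 0 <= t -> history X (grid t n k.+1) (cell t n k).
Proof.
move=> t0; rewrite historyE; apply: measurableI.
  apply: measurableD; rewrite -historyE; apply: (history_hit markovX) => //.
  exact: grid_homo.
by rewrite -historyE; apply: history_preX => //; exact: grid_ge0.
Qed.

Let measurable_cell t n k : 0 <= t -> measurable (cell t n k).
Proof.
move=> t0; have hC : history X (grid t n k.+1) (cell t n k) by exact: cell_history.
by apply: (history_sub markovX hC); exact: grid_ge0.
Qed.

Let trivIset_cell t n : trivIset setT (cell t n).
Proof.
apply: ltn_trivIset => j k jk; apply/seteqP; split => // w [[[hj _] _] [[_ hk] _]].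
apply: hk; apply/T_le; move/T_le : hj => /le_trans; apply.
by rewrite lee_fin grid_homo.
Qed.

(* On the cell [T] and the grid point [s] differ by at most the mesh, which
   gives the factor [exp (lambda0 / (n + 1))]. *)
Let cell_alive x t n k : 0 <= t ->
  (P x (cell t n k `&` X t @^-1` positives) <=
   (expR (lambda0 / n.+1%:R) * (h t x0 / (c1 * c3)))%:E
     * \int[P x]_(w in cell t n k) Phi w)%E.
Proof.
move=> t0; set s := grid t n k.+1; set a := h t x0 / _.
have s0 : 0 <= s by exact: grid_ge0.
have st : s <= t by exact: grid_le.
have a0 : 0 <= a by rewrite divr_ge0 ?fine_prob_ge0 ?mulr_ge0// ltW.
have mC := measurable_cell n k t0.
have E1 : (P x (cell t n k `&` X t @^-1` positives)
    <= (expR (lambda0 * s) * a)%:E * P x (cell t n k))%E.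
  have -> : X t @^-1` positives = X (s + (t - s)) @^-1` positives by rewrite subrKC.
  apply: (@markov_le _ _ _ _ _ markovX x s _ _ _ K) => //.
  - by rewrite subr_ge0.
  - exact: cell_history.
  - by move=> w [].
  move=> y Ky; rewrite -[leLHS]fineK ?alive_fin ?subr_ge0// lee_fin.
  rewrite /a mulrA ler_pdivlMr ?mulr_gt0// -ler_pdivrMl ?expR_gt0//.
  rewrite -expRN -mulNr -/(h (t - s) y); apply: le_trans (alive_from_K s0 st Ky).
  by rewrite le_eqVlt; apply/orP; left; apply/eqP; ring.
apply: le_trans E1 _.
have sT w : cell t n k w -> ((s - n.+1%:R^-1)%:E <= T w)%E.
  move=> [[_ hk] _]; rewrite leNgt; apply/negP => Ts; apply: hk; apply/T_le.
  by apply: le_trans (ltW Ts) _; rewrite lee_fin grid_step.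
have := lee_wpmul2l (_ : 0 <= (expR (lambda0 / n.+1%:R) * a)%:E)%E
  (exp_moment_ge x mC sT).
rewrite lee_fin mulr_ge0 ?expR_ge0// => /(_ isT); apply: le_trans.
rewrite muleA -EFinM le_eqVlt; apply/orP; left; apply/eqP; congr (_%:E * _)%E.
by rewrite mulrAC -expRD; congr (expR _ * _); ring.
Qed.

Let cells_alive x t n : (0 < x)%N -> 0 <= t ->
  (P x ((\bigcup_k cell t n k) `&` X t @^-1` positives) <=
   (expR (lambda0 / n.+1%:R) * (c2 / (c1 * c3) * h t x0))%:E)%E.
Proof.
move=> x_gt0 t0.
pose b := expR (lambda0 / n.+1%:R) * (h t x0 / (c1 * c3)).
have b0 : 0 <= b.
  by rewrite mulr_ge0 ?expR_ge0// divr_ge0 ?fine_prob_ge0 ?mulr_ge0// ltW.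
have mE : measurable (X t @^-1` positives) by exact: (measurable_preX markovX).
have mCE k : measurable (cell t n k `&` X t @^-1` positives).
  by apply: measurableI => //; exact: measurable_cell.
rewrite setI_bigcupl measure_semi_bigcup//; first last.
- exact: bigcupT_measurable.
- exact: trivIset_setIr.
apply: (@le_trans _ _ (b%:E * \int[P x]_(w in \bigcup_k cell t n k) Phi w)%E).
  rewrite ge0_integral_bigcup//; first last.
  - by apply: measurable_funS measurable_Phi.
  - by move=> k; exact: measurable_cell.
  rewrite -nneseriesZl; last by move=> k _; exact: integral_ge0.
  by apply: lee_nneseries => // k _; exact: cell_alive.
have mU : measurable (\bigcup_k cell t n k).
  by apply: bigcupT_measurable => k; exact: measurable_cell.
apply: (@le_trans _ _ (b%:E * c2%:E)%E).
  by rewrite lee_wpmul2l ?lee_fin// moment_le.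
rewrite -EFinM lee_fin /b le_eqVlt; apply/orP; left; apply/eqP; field.
by rewrite !gt_eqF.
Qed.

(* Right-continuity keeps the path in [K] for a while after it has entered it,
   so that a fine grid sees the entrance. *)
Let cell_eventually t w : 0 <= t -> (T w <= t%:E)%E -> (0 < X t w)%N ->
  (forall t, (extinction_time X w <= t%:E)%E -> X t w = 0%N) ->
  \forall n \near \oo, (\bigcup_k cell t n k) w.
Proof.
move=> t0 Tt Xt absorbed.
have T0 : (0 <= T w)%E.
  rewrite leNgt; apply/negP => Tneg.
  have [u Tu u0] : exists2 u, (T w <= u%:E)%E & u < 0.
    case: (T w) Tneg => [r|//|_]; last by exists (-1); rewrite ?leNye ?ltrN10.
    by rewrite lte_fin => r0; exists r.
  by have /T_le[v [v0 vu _]] := Tu; lra.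
have /fineK Tw : T w \is a fin_num by rewrite ge0_fin_numE// (le_lt_trans Tt) ?ltry.
move: Tt T0; rewrite -Tw; set tau := fine _ => taut tau0.
rewrite !lee_fin in taut tau0.
have /T_le[u [u0 utau Xu]] : (T w <= tau%:E)%E by rewrite -Tw.
have : (T w <= u%:E)%E by apply/T_le; exists u.
rewrite -Tw lee_fin => tauu.
have {u0 utau tauu} uE : u = tau by apply/le_anti/andP; split.
(* Entering [K0] at 0 is excluded: the path would be absorbed before [t]. *)
have Ktau : K (X tau w).
  case: Xu => [|X0]; first by rewrite uE.
  suff X0' : X t w = 0%N by rewrite X0' in Xt.
  apply: absorbed; apply/(hitting_time_leP markovX).
  by exists tau; split => //; rewrite -uE.
have [e e0 Xe] := right_constant markovX w tau0.
apply: filterS (near_infty_natSinv_lt (PosNum e0)) => n /= ne.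
have N0 : 0 < n.+1%:R :> R by [].
(* [k / (n + 1)] is the first grid point not before [tau]. *)
pose z := Num.ceil (tau * n.+1%:R); pose k := `|z|%N.
have z0 : 0 <= z.
  by rewrite ceil_ge0; apply: (@lt_le_trans _ _ 0); rewrite ?ltrN10 ?mulr_ge0.
have kz : k%:R = z%:~R :> R by rewrite natr_absz ger0_norm.
have /andP[zl zu] := ceil_itv (tau * n.+1%:R).
rewrite -/z intrB -kz in zl; rewrite -/z -kz in zu.
have gk : tau <= grid t n k.+1.
  by rewrite le_min taut andbT -natr1 addrK ler_pdivlMr.
have gk' : grid t n k.+1 < tau + e.
  apply: le_lt_trans (_ : k%:R / n.+1%:R < _).
    by rewrite ge_min -natr1 addrK lexx.
  have : k%:R / n.+1%:R < tau + n.+1%:R^-1.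
    by rewrite ltr_pdivrMr// mulrDl mulVf ?gt_eqF// -ltrBlDr.
  by move/lt_trans; apply; rewrite ltrD2l.
exists k => //; split; [split|].
- by apply/T_le; rewrite -Tw lee_fin.
- move=> /T_le; rewrite -Tw lee_fin leNgt => /negP; apply.
  rewrite gt_min; apply/orP; left; rewrite ltr_pdivrMr//.
- by rewrite /preimage /= Xe.
Qed.

(** By [cell_eventually], almost every path of this event is counted by
    [cells_alive] for all large [n]; let [n] tend to infinity. *)
Lemma early_return x t : (0 < x)%N -> 0 <= t ->
  (P x ([set w | (T w <= t%:E)%E] `&` X t @^-1` positives)
     <= (c2 / (c1 * c3) * h t x0)%:E)%E.
Proof.
move=> x_gt0 t0; set E := X t @^-1` positives; set C := c2 / _ * _.
have mE : measurable E by exact: (measurable_preX markovX).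
have mU n : measurable ((\bigcup_k cell t n k) `&` E).
  by apply: measurableI => //; apply: bigcupT_measurable => k; exact: measurable_cell.
pose F N := \bigcap_(n >= N) ((\bigcup_k cell t n k) `&` E).
have mF N : measurable (F N) by exact: bigcap_measurableType.
have FC N : (P x (F N) <= C%:E)%E.
  rewrite -[P x _]fineK ?fin_num_prob// lee_fin.
  have : expR (lambda0 / n.+1%:R) * C @[n --> \oo] --> expR (lambda0 * 0) * C.
    apply: cvgM; last exact: cvg_cst.
    apply: continuous_cvg; first exact: continuous_expR.
    by apply: cvgM; [exact: cvg_cst|exact: cvg_harmonic].
  rewrite mulr0 expR0 mul1r.
  move/cvgr_to_ge; apply; near=> n.
  rewrite -lee_fin fineK ?fin_num_prob//.
  apply: le_trans (cells_alive n x_gt0 t0).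
  apply: le_measure; rewrite ?inE// => w; apply.
  by near: n; exact: nbhs_infty_ge.
apply: (@le_trans _ _ (P x (\bigcup_N F N))).
  apply: ae_le_measure.
  - apply: measurableI => //.
    by rewrite -[X in measurable X]setTI; exact: emeasurable_fun_infty_c measurable_T _.
  - exact: bigcupT_measurable.
  apply: filterS (absorbX x) => w abs [Tt Xt].
  have [N _ HN] := cell_eventually t0 Tt Xt abs.
  by exists N => // n /= Nn; split => //; exact: HN.
have Fcvg : P x (F n) @[n --> \oo] --> P x (\bigcup_N F N).
  apply: nondecreasing_cvg_mu => //; first exact: bigcupT_measurable.
  move=> n m nm; apply/subsetPset => w Fw k /= mk; apply: Fw.
  exact: leq_trans mk.
rewrite -(cvg_lim _ Fcvg)//; apply: lime_le; first by apply/cvg_ex; eexists; exact: Fcvg.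
by near=> n.
Unshelve. all: by end_near. Qed.

(** [late_return] and [early_return] each contribute at most
    [c2 / (c1 c3)]. *)
Lemma survival_dominated x t : c1 <= 1 -> (0 < x)%N -> 0 <= t ->
  h t x <= 2 * c2 / (c1 * c3) * h t x0.
Proof.
move=> c1_le1 x_gt0 t0; set E := X t @^-1` positives.
have mE : measurable E by exact: (measurable_preX markovX).
have mL : measurable [set w | (t%:E < T w)%E].
  by rewrite -[X in measurable X]setTI; exact: emeasurable_fun_o_infty measurable_T _.
have mS : measurable [set w | (T w <= t%:E)%E].
  by rewrite -[X in measurable X]setTI; exact: emeasurable_fun_infty_c measurable_T _.
rewrite -lee_fin [X in (X <= _)%E]fineK ?alive_fin//.
apply: (@le_trans _ _ (P x ([set w | (t%:E < T w)%E] `|`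
    ([set w | (T w <= t%:E)%E] `&` E)))).
  apply: le_measure; rewrite ?inE//; first by apply: measurableU => //; exact: measurableI.
  by move=> w Ew; have [Tt|tT] := leP (T w) t%:E; [right|left].
apply: (le_trans (measureU2 _ mL (measurableI _ _ mS mE))).
apply: (le_trans (leeD (late_return x_gt0 t0) (early_return x_gt0 t0))).
rewrite -EFinD lee_fin -mulrDl ler_wpM2r ?fine_prob_ge0//.
have : c2 / c3 <= c2 / (c1 * c3).
  by rewrite ler_pM2l// lef_pV2 ?posrE ?mulr_gt0// ler_piMl// ltW.
lra.
Qed.

End Domination.

(** * Transition kernel and minorization *)

Section Kernel.
Context (R : realType) (d : measure_display) (Omega : measurableType d)
  (X : R -> Omega -> nat) (P : nat -> probability Omega R).
Hypothesis markovX : is_markov_process X P.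
Hypothesis absorbX : zero_absorbing X P.
Implicit Types (s t u : R) (w : Omega) (x y : nat) (A : set nat).

Let pfin x t A : 0 <= t -> P x (X t @^-1` A) \is a fin_num.
Proof. by move=> t0; apply: fin_num_prob; exact: (measurable_preX markovX). Qed.

(** For negative times, where [X t] need not be measurable, the value of [Q] is
    arbitrary. *)
Lemma transition_kernel : exists Q : R -> nat -> probability nat R,
  forall t x A, 0 <= t -> Q t x A = P x (X t @^-1` A).
Proof.
have law (tx : R * nat) : exists nu : probability nat R,
    forall A, 0 <= tx.1 -> nu A = P tx.2 (X tx.1 @^-1` A).
  case: tx => t x /=; have [t0|t0] := leP 0 t; last first.
    by exists (@dirac _ _ 0%N R).
  pose f : {mfun Omega >-> nat} := mfun_Sub (mem_set (mp_measurable markovX t0)).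
  by exists (distribution (P x) f).
have [Q QE] := choice law.
by exists (fun t x => Q (t, x)) => t x A t0; rewrite QE.
Qed.

Context (Q : R -> nat -> probability nat R).
Hypothesis QE : forall t x A, 0 <= t -> Q t x A = P x (X t @^-1` A).

Lemma kernel_semigroup t s x A : 0 <= t -> 0 <= s ->
  Q (t + s) x A = (\int[Q t x]_y Q s y A)%E.
Proof.
move=> t0 s0; have hT : history X t setT by rewrite historyE; exact: measurableT.
have := markov_series markovX x A t0 s0 hT; rewrite setTI => PE.
rewrite QE ?addr_ge0// PE.
rewrite [RHS](eq_integral (fun y => (fine (Q s y A))%:E)); last first.
  by move=> y _; rewrite fineK ?fin_num_prob.
rewrite integral_nat; last by move=> y; exact: fine_prob_ge0.
by apply: eq_eseriesr => y _; rewrite fineK ?fin_num_prob// setTI !QE.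
Qed.

Lemma alive_decreasing x s t : 0 <= s -> s <= t ->
  (P x (X t @^-1` positives) <= P x (X s @^-1` positives))%E.
Proof.
move=> s0 st; have t0 : 0 <= t by exact: le_trans st.
rewrite -(prob_survival markovX absorbX)// -(prob_survival markovX absorbX)//.
apply: le_measure; rewrite ?inE; [exact: (measurable_survival markovX)..|].
by move=> w; rewrite /survival/=; apply: le_lt_trans; rewrite lee_fin.
Qed.

Lemma alive_split x s c : 0 <= s ->
  (forall y, (0 < y)%N -> (P y (X s @^-1` positives) <= c%:E)%E) ->
  (P x (X (1 + s) @^-1` positives) <= c%:E * P x (X 1 @^-1` positives))%E.
Proof.
move=> s0 Pc; have s1 : 0 <= 1 + s by rewrite addr_ge0.
have h1 : history X 1 (X 1 @^-1` positives) by exact: history_preX.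
apply: le_trans (markov_le markovX x ler01 s0 h1 (fun _ => id) Pc).
apply: ae_le_measure.
- exact: (measurable_preX markovX).
- by apply: measurableI; exact: (measurable_preX markovX).
apply: filterS (absorbX x) => w abs Xs; split => //.
have Ss : survival X (1 + s) w by exact: absorbed_survival.
apply: (survival_pos markovX) => //.
by apply: le_lt_trans Ss; rewrite lee_fin lerDl.
Qed.

Lemma conditioned_lawE (mu : probability nat R) t A : 0 <= t -> A `<=` positives ->
  conditioned_law X P mu t A =
  mean mu (fun x => fine (Q t x A)) / mean mu (fun x => fine (Q t x positives)).
Proof.
move=> t0 Ap; rewrite /conditioned_law /cond_prob /initial_law.
congr (fine _ / fine _); apply: eq_integral => x _; rewrite fineK ?fin_num_prob// QE//.
  exact: (prob_alive markovX absorbX).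
exact: (prob_survival markovX absorbX).
Qed.

Context (K : set nat) (x0 : nat) (lambda0 c1 c2 c3 c4 : R).
Hypothesis Kpos : K `<=` positives.
Hypothesis Kx0 : K x0.
Hypothesis lambda0_gt0 : 0 < lambda0.
Hypothesis c1_gt0 : 0 < c1.
Hypothesis c2_gt0 : 0 < c2.
Hypothesis c3_gt0 : 0 < c3.
Hypothesis c4_gt0 : 0 < c4.
Hypothesis h1 : H1 X P K c1.
Hypothesis h2 : H2 X P K x0 lambda0 c2 c3.
Hypothesis h3 : H3 X P x0 c4.

Let h t y : R := fine (P y (X t @^-1` positives)).

Let surv t y : 0 <= t -> fine (P y (survival X t)) = h t y.
Proof. by move=> t0; rewrite (prob_survival markovX absorbX). Qed.

Let h01 t y : 0 <= t -> 0 <= h t y <= 1.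
Proof.
move=> t0; rewrite fine_prob_ge0 fine_prob_le1//.
exact: (measurable_preX markovX).
Qed.

(* The quotient of the infimum by the supremum is at least [c1 > 0], so the
   supremum is not 0, since a division by 0 would give 0. *)
Let harnack_bounds t y z : 0 <= t -> K y -> K z ->
  [/\ c1 * h t y <= h t z, 0 < h t z & c1 <= 1].
Proof.
move=> t0 Ky Kz; have := h1 t0; set S := [set _ | _ in _].
have Sh v : K v -> S (h t v) by exists v => //; rewrite surv.
have S1 : ubound S 1.
  by move=> _ [v _ <-]; rewrite surv//; case/andP: (h01 v t0).
have S0 : lbound S 0.
  by move=> _ [v _ <-]; rewrite surv//; case/andP: (h01 v t0).
have inf_le v : K v -> inf S <= h t v.
  by move=> /Sh Sv; apply: ge_inf => //; exists 0.
have le_sup v : K v -> h t v <= sup S.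
  by move=> /Sh Sv; apply: ub_le_sup => //; exists 1.
have supS0 : 0 <= sup S by apply: le_trans (le_sup _ Ky); case/andP: (h01 y t0).
have [->|sSn0] := eqVneq (sup S) 0; first by rewrite invr0 mulr0 leNgt c1_gt0.
have sS : 0 < sup S by rewrite lt_def sSn0.
rewrite ler_pdivlMr// => c1S.
have i0 : 0 < inf S by apply: (@lt_le_trans _ _ (c1 * sup S)) => //; exact: mulr_gt0.
split.
- apply: le_trans (inf_le _ Kz); apply: le_trans c1S.
  by rewrite ler_pM2l// le_sup.
- by apply: lt_le_trans i0 _; exact: inf_le.
- rewrite -(ler_pM2r sS) mul1r; apply: le_trans c1S _.
  by apply: le_trans (inf_le _ Ky) _; exact: le_sup.
Qed.

(* As above, a vanishing denominator would make the conditional probability 0,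
   which is less than [c4]. *)
Let one_step x : (0 < x)%N ->
  0 < h 1 x /\ c4 * h 1 x <= fine (P x (X 1 @^-1` [set x0])).
Proof.
move=> x_gt0.
have : c4 <= cond_prob (P x) (X 1 @^-1` [set x0]) (survival X 1).
  apply: le_trans h3 _; apply: ge_inf; last by exists x.
  by exists 0 => _ [v _ <-]; rewrite divr_ge0// fine_ge0.
have x0p : [set x0] `<=` positives by move=> _ ->; exact: Kpos.
rewrite /cond_prob (prob_alive markovX absorbX)// surv//.
have [h0|] := ltP 0 (h 1 x); first by rewrite ler_pdivlMr.
have /andP[h0 _] := h01 x (@ler01 R) => h0'.
have -> : h 1 x = 0 by apply/le_anti/andP.
by rewrite invr0 mulr0 leNgt c4_gt0.
Qed.

Let x0_gt0 : (0 < x0)%N. Proof. exact: Kpos. Qed.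

Let step_mass s x : 0 <= s ->
  fine (P x (X 1 @^-1` [set x0])) * h s x0 <= h (1 + s) x.
Proof.
move=> s0; have hA : history X 1 (X 1 @^-1` [set x0]) by exact: history_preX.
have hs : 0 <= h s x0 by case/andP: (h01 x0 s0).
have mp r A : 0 <= r -> measurable (X r @^-1` A) by exact: (measurable_preX markovX).
have s1 : 0 <= 1 + s by rewrite addr_ge0.
rewrite -lee_fin mulrC EFinM [X in (_ * X)%E]fineK ?pfin//.
rewrite [leRHS]fineK ?pfin//.
apply: (@le_trans _ _ (P x (X 1 @^-1` [set x0] `&` X (1 + s) @^-1` positives))).
  apply: (@markov_ge _ _ _ _ _ markovX x 1 s _ _ [set x0]) => // y ->.
  by rewrite /h fineK ?pfin.
by apply: le_measure; rewrite ?inE; [apply: measurableI; exact: mp|exact: mp|move=> w []].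
Qed.

(** Reach [x0] at time 1 and survive from there. *)
Lemma alive_gt0 t x : 0 <= t -> (0 < x)%N -> 0 < h t x.
Proof.
move=> t0 x_gt0; have [h1x qx] := one_step x_gt0.
have [_ hx0 _] := harnack_bounds t0 Kx0 Kx0.
have mp r A : 0 <= r -> measurable (X r @^-1` A) by exact: (measurable_preX markovX).
apply: (@lt_le_trans _ _ (h (1 + t) x)).
  apply: lt_le_trans (step_mass x t0); rewrite mulr_gt0//.
  by apply: lt_le_trans qx; rewrite mulr_gt0.
have t1 : 0 <= 1 + t by rewrite addr_ge0.
apply: fine_le; rewrite ?pfin//.
by apply: alive_decreasing => //; rewrite lerDr.
Qed.

(** Domination bounds [h (1 + s) x] by [2 c2 / (c1 c3) h s x0 h 1 x], and [x0]
    carries at least the fraction [c4] of the mass [h 1 x]. *)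
Lemma doeblin_minorization s x : 0 <= s -> (0 < x)%N ->
  c1 * c3 * c4 / (2 * c2) * h (1 + s) x <=
  fine (P x (X 1 @^-1` [set x0])) * h s x0.
Proof.
move=> s0 x_gt0; have [h1x qx] := one_step x_gt0.
have mp r A : 0 <= r -> measurable (X r @^-1` A) by exact: (measurable_preX markovX).
have [_ hx0 c1_le1] := harnack_bounds s0 Kx0 Kx0.
have dom y : (0 < y)%N -> h s y <= 2 * c2 / (c1 * c3) * h s x0.
  move=> y_gt0; apply: (survival_dominated markovX absorbX Kpos lambda0_gt0
    c1_gt0 c2_gt0 c3_gt0 _ _ h2.2) => //= [t y' z t0 Ky Kz|y' y'_gt0].
    by have [] := harnack_bounds t0 Ky Kz.
  by apply: le_trans h2.1; apply: ereal_sup_ubound; exists y'.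
have s1 : 0 <= 1 + s by rewrite addr_ge0.
have /(alive_split x s0) : forall y, (0 < y)%N ->
    (P y (X s @^-1` positives) <= (2 * c2 / (c1 * c3) * h s x0)%:E)%E.
  by move=> y /dom; rewrite -lee_fin [X in (X <= _)%E]fineK ?pfin.
rewrite -[P x (X (1 + s) @^-1` _)]fineK ?pfin// -[P x (X 1 @^-1` _)]fineK ?pfin//.
rewrite -EFinM lee_fin -/(h (1 + s) x) -/(h 1 x) => split_x.
have b_ge0 : 0 <= c1 * c3 * c4 / (2 * c2) by rewrite ltW// divr_gt0 ?mulr_gt0.
apply: le_trans (ler_wpM2l b_ge0 split_x) _.
rewrite [leLHS](_ : _ = c4 * h 1 x * h s x0); first by rewrite ler_wpM2r ?fine_prob_ge0.
by field; rewrite !gt_eqF.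
Qed.

End Kernel.

(** * Conclusion *)

Theorem theorem1 (R : realType) (d : measure_display)
    (Omega : measurableType d) (X : R -> Omega -> nat)
    (P : nat -> probability Omega R)
    (K : set nat) (x0 : nat) (lambda0 c1 c2 c3 c4 : R) :
  is_markov_process X P ->
  stable X P ->
  zero_absorbing X P ->
  almost_sure_extinction X P ->
  finite_set K -> K `<=` positives -> K x0 ->
  0 < lambda0 -> 0 < c1 -> 0 < c2 -> 0 < c3 -> 0 < c4 ->
  H1 X P K c1 ->
  H2 X P K x0 lambda0 c2 c3 ->
  H3 X P x0 c4 ->
  exists rho : probability nat R,
    [/\ is_qsd X P rho,
        forall rho' : probability nat R, is_qsd X P rho' ->
          forall A : set nat, rho' A = rho A
      & forall mu : probability nat R, supported_on_positives mu ->
          forall t : R, 0 <= t ->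
            (tv_norm (fun A : set nat =>
               (conditioned_law X P mu t A - fine (rho A))%R)
             <= (2 * (1 - c1 * c3 * c4 / (2 * c2)) ^+ Num.truncn t)%:E)%E].
Proof.
move=> markovX _ absorbX _ _ Kpos Kx0 l0 c1_gt0 c2_gt0 c3_gt0 c4_gt0 h1 h2 h3.
have [Q QE] := transition_kernel markovX.
have alive := alive_gt0 markovX absorbX Kpos Kx0 c1_gt0 c4_gt0 h1 h3.
have b_gt0 : 0 < c1 * c3 * c4 / (2 * c2) by rewrite divr_gt0 ?mulr_gt0.
have QE' t x A : 0 <= t -> fine (Q t x A) = fine (P x (X t @^-1` A)).
  by move=> t0; rewrite QE.
have Q_gt0 t x : 0 <= t -> (0 < x)%N -> 0 < fine (Q t x positives).
  by move=> t0 x_gt0; rewrite QE' ?alive.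
have [] := @qsd_of_doeblin R Q x0 _ (kernel_semigroup markovX QE) _ Q_gt0
  (Kpos _ Kx0) b_gt0 _.
- by move=> t t0; rewrite QE// prob_dead.
- move=> s x s0 x_gt0; have s1 : 0 <= 1 + s by rewrite addr_ge0.
  rewrite /= !QE'//.
  exact: (doeblin_minorization markovX absorbX Kpos Kx0 l0 c1_gt0 c2_gt0 c3_gt0
    c4_gt0 h1 h2 h3).
move=> rho [rho0 rho_qsd rho_unique rho_near].
have lawE mu t A := @conditioned_lawE _ _ _ _ _ markovX absorbX Q QE mu t A.
have mean_pos (mu : probability nat R) t : 0 <= t -> mu [set 0%N] = 0%E ->
    0 < mean mu (fun x => fine (Q t x positives)).
  by move=> t0 mu0; exact: mean_survival_gt0.
exists rho; split.
- split=> // t t0 A Ap; rewrite lawE// rho_qsd// mulfK//.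
  by rewrite gt_eqF// mean_pos.
- move=> rho' [rho'0 rho'_qsd] A.
  have to_pos (nu : probability nat R) : nu [set 0%N] = 0%E ->
      nu A = nu (A `&` positives).
    move=> nu0; apply: ae_eq_measure => //; exists [set 0%N]; split => // w /=.
    by case: w => [//|w] H; exfalso; apply: H; split => // -[].
  rewrite !to_pos// -[LHS]fineK ?fin_num_prob// -[RHS]fineK ?fin_num_prob//.
  congr (_%:E); apply: rho_unique => // t B t0 Bp.
  by rewrite (rho'_qsd t t0 B Bp) lawE// mulfVK// gt_eqF// mean_pos.
- move=> mu mu0 t t0; apply: tv_norm_le => [A B Ap Bp AB|A Ap]; last first.
    by rewrite lawE// rho_near.
  rewrite !lawE// ?subUset// fine_probU//.
  rewrite (_ : mean mu (fun x => fine (Q t x (A `|` B))) =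
    mean mu (fun x => fine (Q t x A)) + mean mu (fun x => fine (Q t x B))).
    by rewrite mulrDl opprD addrACA.
  rewrite -(@meanD _ _ _ _ 1) => [|y|y].
  - by congr mean; apply/funext => x; rewrite fine_probU.
  - by rewrite ger0_norm ?fine_prob_ge0 ?fine_prob_le1.
  - by rewrite ger0_norm ?fine_prob_ge0 ?fine_prob_le1.
Qed.
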